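(* Let $X$ be an Archimedean vector lattice, and let $\boldsymbol{x}=(x_1,\ldots,x_n)\in X^n$ for some $n\in\mathbb{N}$. Then the following three conditions are equivalent: (a) there is a vector lattice homomorphism $\Phi_{\boldsymbol{x}}\colon H_n\to X$ which satisfies $\Phi_{\boldsymbol{x}}(\pi_i^{(n)})=x_i$ for each $i\in\{1,\ldots,n\}$; (b) the norm $\|\cdot\|_e$ is complete on the closed sublattice of $(I_e,\|\cdot\|_e)$ generated by the elements $x_1,\ldots,x_n$, where $e=|x_1|\vee\cdots\vee|x_n|$; (c) there is a positive element $e\in X$ such that $e\ge|x_1|\vee\cdots\vee|x_n|$ and the norm $\|\cdot\|_e$ is complete on the closed sublattice of $(I_e,\|\cdot\|_e)$ generated by $x_1,\ldots,x_n$. When one and hence all three of these conditions are satisfied, the vector lattice homomorphism $\Phi_{\boldsymbol{x}}\colon H_n\to X$ satisfying $\Phi_{\boldsymbol{x}}(\pi_i^{(n)})=x_i$ for each $i\in\{1,\ldots,n\}$ is unique.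
   Context: All vector lattices are over $\mathbb{R}$, and $\mathbb{N}=\{1,2,\ldots\}$. Sublattices are linear sublattices (closed under linear operations and $\vee,\wedge$), and a vector lattice homomorphism is a linear map preserving $\vee$ and $\wedge$. A vector lattice $X$ is Archimedean if, whenever $x,y\in X^+$ satisfy $nx\le y$ for each $n\in\mathbb{N}$, it follows that $x=0$. A function $f\colon\mathbb{R}^n\to\mathbb{R}$ is positively homogeneous if $f(\lambda t)=\lambda f(t)$ for each $\lambda\in[0,\infty)$ and $t\in\mathbb{R}^n$. $H_n$ denotes the vector lattice (with pointwise operations) of positively homogeneous, continuous functions $\mathbb{R}^n\to\mathbb{R}$, and $\pi_i^{(n)}\in H_n$ is the $i$-th coordinate projection $(t_1,\ldots,t_n)\mapsto t_i$. For $e\in X^+$, let $I_e=\{x\in X: |x|\le\lambda e\text{ for some }\lambda\in[0,\infty)\}$ be the order ideal generated by $e$, and let $\|x\|_e=\inf\{\lambda\in[0,\infty): |x|\le\lambda e\}$ for $x\in I_e$; this is a lattice norm on $I_e$ when $X$ is Archimedean. The closed sublattice of $(I_e,\|\cdot\|_e)$ generated by $x_1,\ldots,x_n$ is the smallest $\|\cdot\|_e$-closed sublattice of $I_e$ containing these elements. *)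

(* Defs.v *)
From HB Require Import structures.
From mathcomp Require Import all_boot all_order all_algebra.
From mathcomp Require Import all_classical all_reals all_analysis.

Set Implicit Arguments.
Unset Strict Implicit.
Unset Printing Implicit Defensive.

Import Order.TTheory GRing.Theory Num.Theory.
Import numFieldNormedType.Exports.

Local Open Scope classical_set_scope.
Local Open Scope ring_scope.

(* The order is a field of the mixin, and is turned into an instance of the
   order library right below: HB does not accept a structure that inherits from
   both GRing.Lmodule and Order.Lattice, as realDomainType would be a second,
   incomparable common descendant of Zmodule and Lattice. *)
HB.mixin Record Lmodule_isVectorLattice (R : realType) V
    of GRing.Lmodule R V := {
  vle : rel V ;
  vmeet : V -> V -> V ;
  vjoin : V -> V -> V ;
  vle_refl : reflexive vle ;
  vle_anti : antisymmetric vle ;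
  vle_trans : transitive vle ;
  vlexI : forall x y z, vle x (vmeet y z) = vle x y && vle x z ;
  vleUx : forall x y z, vle (vjoin x y) z = vle x z && vle y z ;
  vleD2l : forall z x y, vle x y -> vle (z + x) (z + y) ;
  vscale_ge0 : forall (a : R) x, 0 <= a -> vle 0 x -> vle 0 (a *: x)
}.

#[short(type="vectorLatticeType")]
HB.structure Definition VectorLattice (R : realType) :=
  { V of GRing.Lmodule R V & Lmodule_isVectorLattice R V }.

HB.instance Definition _ (R : realType) (X : vectorLatticeType R) :=
  Order.Le_isPOrder.Build ring_display (VectorLattice.sort X)
    vle_refl vle_anti vle_trans.

HB.instance Definition _ (R : realType) (X : vectorLatticeType R) :=
  Order.POrder_MeetJoin_isLattice.Build ring_display (VectorLattice.sort X)
    vlexI vleUx.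

Section VectorLattice.
Variables (R : realType) (X : vectorLatticeType R).
Implicit Types (e x y : X) (C S : set X).

Lemma vlat_leD x1 y1 x2 y2 : x1 <= y1 -> x2 <= y2 -> x1 + x2 <= y1 + y2.
Proof.
move=> h1 h2; apply: le_trans (vleD2l _ _ _ h2).
by rewrite ![_ + x2]addrC; exact: vleD2l.
Qed.

Lemma vlat_scale (a : R) x y : 0 <= a -> x <= y -> a *: x <= a *: y.
Proof.
move=> a0 xy; have /(vscale_ge0 _ _ a0) h : 0 <= - x + y.
  by rewrite -(addNr x); exact: vleD2l.
by have := vleD2l (a *: x) _ _ h; rewrite addr0 -scalerDr addrA subrr add0r.
Qed.

Definition archimedean_vlat : Prop :=
  forall x y, 0 <= x -> 0 <= y ->
    (forall m : nat, (0 < m)%N -> m%:R *: x <= y) -> x = 0.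

Definition vabs x : X := (x `|` - x)%O.

Lemma vabs_ge0 x : 0 <= vabs x.
Proof.
have h : 0 <= vabs x + vabs x.
  apply: (@le_trans _ _ (vabs x - x)).
    have := @vleD2l R X (- x) _ _ (leUl x (- x) : x <= vabs x).
    by rewrite addNr addrC.
  exact: (@vleD2l R X _ _ _ (leUr _ _)).
have -> : vabs x = 2^-1 *: (vabs x + vabs x).
  by rewrite -[X in X + X]scale1r -scalerDl scalerA mulVf ?scale1r ?pnatr_eq0.
by apply: vscale_ge0 => //; rewrite invr_ge0.
Qed.

(* |x_1| \/ ... \/ |x_n|: the index 0 is neutral because every |x_i| >= 0;
   see vabs_supP. *)
Definition vabs_sup n (x : 'I_n -> X) : X :=
  \big[Order.join/0]_(i < n) vabs (x i).

Lemma vabs_supP n (x : 'I_n -> X) (z : X) : (0 < n)%N ->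
  vabs_sup x <= z <-> forall i, vabs (x i) <= z.
Proof.
move=> n0; split=> [xz i|xz]; last first.
  apply: (big_ind (fun u => u <= z)) => [|u v uz vz|i _]; last exact: xz.
    exact: le_trans (vabs_ge0 _) (xz (Ordinal n0)).
  by rewrite leUx uz vz.
apply: le_trans xz; rewrite /vabs_sup; elim: n x i {n0} => [x []//|n IH x i].
rewrite big_ord_recl; case: (unliftP ord0 i) => [j|] ->; last exact: leUl.
exact: le_trans (IH (fun k => x (lift ord0 k)) j) (leUr _ _).
Qed.

Definition order_ideal e : set X :=
  [set x | exists l : R, 0 <= l /\ vabs x <= l *: e].

Definition enorm e x : R := inf [set l : R | 0 <= l /\ vabs x <= l *: e].

Definition sublattice S : Prop :=
  [/\ S 0,
      forall (a : R) x y, S x -> S y -> S (a *: x + y),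
      forall x y, S x -> S y -> S (x `|` y)%O
    & forall x y, S x -> S y -> S (x `&` y)%O].

Definition enorm_closed e S : Prop :=
  forall y, order_ideal e y ->
    (forall eps : R, 0 < eps -> exists2 s, S s & enorm e (y - s) < eps) -> S y.

Definition closed_sublattice e S : Prop :=
  [/\ S `<=` order_ideal e, sublattice S & enorm_closed e S].

Definition closed_sublattice_gen e n (x : 'I_n -> X) : set X :=
  smallest (closed_sublattice e) (range x).

(* Closed sublattices of I_e are stable under intersection and I_e is one of
   them, so that the set above is itself a closed sublattice of I_e. *)
Lemma order_ideal_closed e : 0 <= e -> closed_sublattice e (order_ideal e).
Proof.
move=> e0.
have le_e (k l : R) : k <= l -> k *: e <= l *: e.
  move=> kl; have := vleD2l (k *: e) _ _ (vscale_ge0 (l - k) e _ e0).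
  by rewrite addr0 -scalerDl [k + _]addrC subrK subr_ge0; exact.
split=> //; split.
- by exists 0; rewrite lexx scale0r /vabs oppr0 joinxx.
- move=> a x y [k [k0]]; rewrite leUx => /andP[x1 x2].
  move=> [l [l0]]; rewrite leUx => /andP[y1 y2].
  exists (`|a| * k + l); split; first by rewrite addr_ge0 ?mulr_ge0.
  rewrite leUx scalerDl -scalerA opprD.
  apply/andP; split; apply: vlat_leD => //.
    have [a0|a0] := leP 0 a; first by rewrite ger0_norm// vlat_scale.
    rewrite ltr0_norm// -[a in a *: x]opprK scaleNr -scalerN.
    by rewrite vlat_scale// oppr_ge0 ltW.
  have [a0|a0] := leP 0 a; first by rewrite ger0_norm// -scalerN vlat_scale.
  by rewrite ltr0_norm// -scaleNr vlat_scale// oppr_ge0 ltW.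
- move=> x y [k [k0]]; rewrite leUx => /andP[x1 x2].
  move=> [l [l0]]; rewrite leUx => /andP[y1 y2].
  have kl : k <= k + l by rewrite lerDl.
  have lk : l <= k + l by rewrite lerDr.
  exists (k + l); split; first exact: addr_ge0.
  rewrite 2!leUx (le_trans x1 (le_e _ _ kl)) (le_trans y1 (le_e _ _ lk)) /=.
  apply: le_trans (le_trans x2 (le_e _ _ kl)).
  have := vleD2l (- x - (x `|` y)%O) _ _ (leUl x y).
  by rewrite addrAC addNr add0r subrK.
- move=> x y [k [k0]]; rewrite leUx => /andP[x1 x2].
  move=> [l [l0]]; rewrite leUx => /andP[y1 y2].
  have kl : k <= k + l by rewrite lerDl.
  have lk : l <= k + l by rewrite lerDr.
  exists (k + l); split; first exact: addr_ge0.
  rewrite leUx (le_trans (leIl _ _) (le_trans x1 (le_e _ _ kl))) /=.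
  have : - ((k + l) *: e) <= (x `&` y)%O.
    rewrite lexI; apply/andP; split.
      have := vleD2l (x - (k + l) *: e) _ _ (le_trans x2 (le_e _ _ kl)).
      by rewrite addrAC subrr add0r subrK.
    have := vleD2l (y - (k + l) *: e) _ _ (le_trans y2 (le_e _ _ lk)).
    by rewrite addrAC subrr add0r subrK.
  move=> /(vleD2l ((k + l) *: e - (x `&` y)%O)).
  by rewrite addrAC subrr add0r subrK.
Qed.

Lemma closed_sublattice_gen_closed e n (x : 'I_n -> X) :
  0 <= e -> (forall i, vabs (x i) <= e) ->
  closed_sublattice e (closed_sublattice_gen e x).
Proof.
move=> e0 xe; have Ie := order_ideal_closed e0.
have xI : range x `<=` order_ideal e.
  by move=> _ [i _ <-]; exists 1; rewrite ler01 scale1r.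
split.
- exact: smallest_sub.
- split=> [M [[_ [M0 _ _ _] _] _]//|a y z Cy Cz M CM|y z Cy Cz M CM
          |y z Cy Cz M CM];
    have [[_ [_ ML MU MI] _] _] := CM.
  + by apply: ML; [exact: Cy|exact: Cz].
  + by apply: MU; [exact: Cy|exact: Cz].
  + by apply: MI; [exact: Cy|exact: Cz].
- move=> y Iy Cy M CM; have [[_ _ Mc] _] := CM.
  by apply: Mc => // eps /Cy[s Cs ys]; exists s => //; exact: Cs.
Qed.

Definition enorm_cauchy e (u : nat -> X) : Prop :=
  forall eps : R, 0 < eps ->
    exists N, forall k l, (N <= k)%N -> (N <= l)%N -> enorm e (u k - u l) < eps.

Definition enorm_cvg e (u : nat -> X) y : Prop :=
  forall eps : R, 0 < eps ->
    exists N, forall k, (N <= k)%N -> enorm e (u k - y) < eps.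

Definition enorm_complete_on e C : Prop :=
  forall u : nat -> X, (forall k, C (u k)) -> enorm_cauchy e u ->
    exists2 y, C y & enorm_cvg e u y.

End VectorLattice.

Definition vlat_hom (R : realType) (X Y : vectorLatticeType R) (f : X -> Y) :
    Prop :=
  [/\ linear f, {morph f : x y / (x `|` y)%O} & {morph f : x y / (x `&` y)%O}].

Section PositivelyHomogeneous.
Variables (R : realType) (n : nat).

Definition pos_homogeneous (f : 'rV[R]_n -> R) : Prop :=
  forall (l : R) t, 0 <= l -> f (l *: t) = l * f t.

(* The codomain R^o is R seen as a module over itself, so that functions into it
   have the pointwise module and lattice structures of the library. *)
Definition ph_continuous : {pred 'rV[R]_n -> R^o} :=
  fun f => `[< pos_homogeneous f /\ continuous (f : 'rV[R]_n -> R) >].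

Fact ph_continuous_submod : submod_closed ph_continuous.
Proof.
split.
  by apply/asboolP; split=> [l t _|]; [rewrite /= mulr0|exact: cst_continuous].
move=> a f g /asboolP[hf cf] /asboolP[hg cg]; apply/asboolP; split.
  move=> l t l0; change (a * f (l *: t) + g (l *: t) = l * (a * f t + g t)).
  have -> : f (l *: t) = l * f t by exact: hf.
  have -> : g (l *: t) = l * g t by exact: hg.
  by rewrite mulrDr mulrCA.
move=> t; apply: (@continuousD _ R^o); last exact: cg.
by apply: (@continuousZr _ R^o); exact: cf.
Qed.

Fact ph_continuous_meet : Order.ClosedPredicates.meet_closed ph_continuous.
Proof.
move=> f g /asboolP[hf cf] /asboolP[hg cg].
have -> : (f `&` g)%O = (fun t => Num.min (f t : R) (g t)).
  by apply/funext => t; rewrite -meetEtotal.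
apply/asboolP; split=> [l t l0|t].
  have -> : f (l *: t) = l * f t by exact: hf.
  have -> : g (l *: t) = l * g t by exact: hg.
  by rewrite minr_pMr.
exact: continuous_min (cf t) (cg t).
Qed.

Fact ph_continuous_join : Order.ClosedPredicates.join_closed ph_continuous.
Proof.
move=> f g /asboolP[hf cf] /asboolP[hg cg].
have -> : (f `|` g)%O = (fun t => Num.max (f t : R) (g t)).
  by apply/funext => t; rewrite -joinEtotal.
apply/asboolP; split=> [l t l0|t].
  have -> : f (l *: t) = l * f t by exact: hf.
  have -> : g (l *: t) = l * g t by exact: hg.
  by rewrite maxr_pMr.
exact: continuous_max (cf t) (cg t).
Qed.

Record phfun := Phfun {
  phfun_fun :> 'rV[R]_n -> R^o ;
  phfun_funP : phfun_fun \in ph_continuous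
}.

HB.instance Definition _ := [isSub for phfun_fun].
HB.instance Definition _ := [Choice of phfun by <:].
HB.instance Definition _ := GRing.SubChoice_isSubLmodule.Build R _ _ phfun
  ph_continuous_submod.
HB.instance Definition _ := Order.SubChoice_isSubLattice.Build _ _ _
  ring_display phfun ph_continuous_meet ph_continuous_join.

Fact phfun_leD2l (h f g : phfun) : f <= g -> h + f <= h + g.
Proof.
move=> /lefP fg; apply/lefP => t.
by change ((h t : R) + f t <= h t + g t); rewrite lerD2l; exact: fg.
Qed.

Fact phfun_scale_ge0 (a : R) (f : phfun) : 0 <= a -> 0 <= f -> 0 <= a *: f.
Proof.
move=> a0 /lefP f0; apply/lefP => t.
by change (0 <= a * f t); apply: mulr_ge0 => //; exact: f0.
Qed.

HB.instance Definition _ := Lmodule_isVectorLattice.Build R phfun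
  (@Order.le_refl _ phfun) (@Order.le_anti _ phfun) (@Order.le_trans _ phfun)
  (@Order.lexI _ phfun) (@Order.leUx _ phfun) phfun_leD2l phfun_scale_ge0.

Lemma phfun_addE (f g : phfun) t : (f + g) t = f t + g t. Proof. by []. Qed.
Lemma phfun_scaleE (a : R) (f : phfun) t : (a *: f) t = a * f t.
Proof. by []. Qed.
Lemma phfun_joinE (f g : phfun) t : (f `|` g)%O t = Num.max (f t) (g t).
Proof. exact: joinEtotal. Qed.
Lemma phfun_meetE (f g : phfun) t : (f `&` g)%O t = Num.min (f t) (g t).
Proof. exact: meetEtotal. Qed.
Lemma phfun_leP (f g : phfun) : reflect (forall t, f t <= g t) (f <= g).
Proof. exact: lefP. Qed.

Fact phfun_proj_subproof (i : 'I_n) :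
  (fun t : 'rV[R]_n => t ord0 i) \in ph_continuous.
Proof.
apply/asboolP; split=> [l t _|]; first by rewrite mxE.
exact: coord_continuous.
Qed.

Definition phfun_proj (i : 'I_n) : phfun := Phfun (phfun_proj_subproof i).

End PositivelyHomogeneous.

(* Main.v *)
Require Import Defs.
From mathcomp Require Import all_boot all_order all_algebra.
From mathcomp Require Import all_classical all_reals all_analysis.
From mathcomp Require Import ring lra.

(** Write H_n for the lattice of positively homogeneous continuous functions,
    pi_i for its coordinate projections, h for |pi_1| \/ ... \/ |pi_n|, and e
    for an upper bound of |x_1| \/ ... \/ |x_n|.  The function h is an order
    unit of H_n, and every homomorphism sending each pi_i to x_i sends h to
    |x_1| \/ ... \/ |x_n|; so H_n with the norm given by h, which is the
    uniform norm on the sphere h = 1, is to be compared with X with the norm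
    given by e.

    Everything rests on the relation lattice_linear between H_n and X, the
    sublattice of H_n x X generated by the pairs (pi_i, x_i): it relates
    p(pi_1, ..., pi_n) to p(x_1, ..., x_n) for each lattice-linear expression
    p.  It has two properties.
    - It is monotone (lattice_linear_le): an inequality between
      lattice-linear expressions that holds in the real numbers holds in X.
      Both entries of a related pair are differences of finite suprema of the
      same linear combinations, so the claim reduces to a finite family of
      linear forms whose maximum is everywhere nonnegative, and there it is
      Gordan's theorem of the alternative, proved by Fourier-Motzkin
      elimination carried out directly in X (fourier_motzkin).
    - Its domain is dense in H_n (lattice_linear_dense): on the sphere h = 1
      the function h is the constant 1, so this is the lattice form of the
      Stone-Weierstrass theorem.

    (c) implies (a): by monotonicity the relation is 1-Lipschitz from the norm
    of h to that of e, so its closure (approximable) is single-valued because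
    X is Archimedean, and it is total because its domain is dense and the
    closed sublattice generated by the x_i is complete.  Lattice operations
    are continuous for both norms, so this closure is a homomorphism.

    (a) implies (b): take e = |x_1| \/ ... \/ |x_n|.  An element of the range
    of Phi with |Phi f| <= l e is the image of the truncation of f between
    -l h and l h, so a rapidly convergent series in the range lifts to a series
    converging uniformly in H_n (hom_range_cvg).  The range is thus complete,
    hence closed, and contains the closed sublattice generated by the x_i.

    Uniqueness: the graph of any such homomorphism is contained in the closure
    of lattice_linear, which is single-valued. *)

Set Implicit Arguments.
Unset Strict Implicit.
Unset Printing Implicit Defensive.

Import Order.TTheory GRing.Theory Num.Theory.
Import numFieldNormedType.Exports.
Local Open Scope classical_set_scope.
Local Open Scope ring_scope.

(** * Order and lattice identities in a vector lattice *)

Section VectorLatticeTheory.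
Variables (R : realType) (X : vectorLatticeType R).
Implicit Types (d e x y z : X) (a b : R).

Lemma vlat_leD2r z x y : (x + z <= y + z) = (x <= y).
Proof.
apply/idP/idP => [h|h]; last exact: vlat_leD.
by rewrite -[x](addrK z) -[y](addrK z); exact: vlat_leD.
Qed.

Lemma vlat_leBlDr x y z : (x - y <= z) = (x <= z + y).
Proof. by rewrite -[LHS](vlat_leD2r y) subrK. Qed.

Lemma vlat_leBrDr x y z : (x <= y - z) = (x + z <= y).
Proof. by rewrite -[LHS](vlat_leD2r z) subrK. Qed.

Lemma vlat_subr_ge0 x y : (0 <= y - x) = (x <= y).
Proof. by rewrite vlat_leBrDr add0r. Qed.

Lemma vlat_leN2 x y : (- x <= - y) = (y <= x).
Proof. by rewrite -[LHS]vlat_subr_ge0 opprK addrC vlat_subr_ge0. Qed.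

Lemma vlat_scale_r a b x : 0 <= x -> a <= b -> a *: x <= b *: x.
Proof.
move=> x0 ab; rewrite -vlat_subr_ge0 -scalerBl; apply: vscale_ge0 => //.
by rewrite subr_ge0.
Qed.

Lemma vlat_scale_pos a x y : 0 < a -> (a *: x <= y) = (x <= a^-1 *: y).
Proof.
move=> a0; apply/idP/idP => h.
  have := vlat_scale (a := a^-1) _ h; rewrite scalerA mulVf ?gt_eqF// scale1r.
  by apply; rewrite invr_ge0 ltW.
have := vlat_scale (a := a) _ h; rewrite scalerA mulfV ?gt_eqF// scale1r.
by apply; rewrite ltW.
Qed.

Lemma vlat_joinDr x y z : ((x `|` y) + z = (x + z) `|` (y + z))%O.
Proof.
apply/eqP; rewrite eq_le; apply/andP; split.
  by rewrite -vlat_leBrDr leUx !vlat_leBrDr leUl leUr.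
by rewrite leUx !vlat_leD2r leUl leUr.
Qed.

Lemma vlat_meetN x y : (x `&` y = - ((- x) `|` (- y)))%O.
Proof.
apply/eqP; rewrite eq_le; apply/andP; split.
  by rewrite -vlat_leN2 opprK leUx !vlat_leN2 leIl leIr.
by rewrite lexI; apply/andP; split; rewrite -vlat_leN2 opprK ?leUl ?leUr.
Qed.

Lemma vabs_subP x y d :
  reflect (x <= y + d /\ y <= x + d) (vabs (x - y) <= d).
Proof.
rewrite /vabs leUx opprB !vlat_leBlDr ![d + _]addrC.
exact: andP.
Qed.

Lemma vabsN x : vabs (- x) = vabs x.
Proof. by rewrite /vabs opprK joinC. Qed.

Lemma vabs_subC x y : vabs (x - y) = vabs (y - x).
Proof. by rewrite /vabs joinC !opprB. Qed.

Lemma vabsP x d : reflect (x <= d /\ - x <= d) (vabs x <= d).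
Proof. by rewrite /vabs leUx; exact: andP. Qed.

Lemma vabs_dist_trans y x z d1 d2 :
  vabs (x - y) <= d1 -> vabs (y - z) <= d2 -> vabs (x - z) <= d1 + d2.
Proof.
move=> /vabs_subP[a1 b1] /vabs_subP[a2 b2]; apply/vabs_subP; split.
  by apply: (le_trans a1); rewrite [d1 + _]addrC addrA vlat_leD2r.
by apply: (le_trans b2); rewrite addrA vlat_leD2r.
Qed.

Lemma vabs_dist_lin a x x' y y' d1 d2 :
  vabs (x - x') <= d1 -> vabs (y - y') <= d2 ->
  vabs ((a *: x + y) - (a *: x' + y')) <= `|a| *: d1 + d2.
Proof.
move=> /vabsP[h1 h2] /vabsP[h3 h4].
rewrite opprD addrACA -scalerBr; apply/vabsP; split.
  apply: vlat_leD => //; have [a0|a0] := leP 0 a.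
    by rewrite ger0_norm//; exact: vlat_scale.
  rewrite ltr0_norm// -[a in a *: (_ - _)]opprK scaleNr -scalerN.
  by rewrite vlat_scale// oppr_ge0 ltW.
rewrite opprD; apply: vlat_leD => //; have [a0|a0] := leP 0 a.
  by rewrite ger0_norm// -scalerN; exact: vlat_scale.
by rewrite ltr0_norm// -scaleNr vlat_scale// oppr_ge0 ltW.
Qed.

(** The join is nonexpansive for the distances given by an order unit; this is
    what makes lattice operations pass to limits. *)
Lemma vabs_dist_join x x' y y' d :
  vabs (x - x') <= d -> vabs (y - y') <= d ->
  vabs ((x `|` y)%O - (x' `|` y')%O) <= d.
Proof.
move=> /vabs_subP[h1 h2] /vabs_subP[h3 h4].
by apply/vabs_subP; split; rewrite vlat_joinDr; exact: leU2.
Qed.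

Lemma vabs_dist_meet x x' y y' d :
  vabs (x - x') <= d -> vabs (y - y') <= d ->
  vabs ((x `&` y)%O - (x' `&` y')%O) <= d.
Proof.
move=> h1 h2; rewrite !vlat_meetN opprK addrC vabs_subC.
by apply: vabs_dist_join; rewrite -opprD vabsN.
Qed.

Lemma archimedean_vabs_eq0 e x : archimedean_vlat X -> 0 <= e ->
  (forall eps : R, 0 < eps -> vabs x <= eps *: e) -> x = 0.
Proof.
move=> hX e0 h; have /hX H : 0 <= vabs x by exact: vabs_ge0.
have x0 : vabs x = 0.
  apply: H e0 _ => m m0; rewrite vlat_scale_pos ?ltr0n//.
  by apply: h; rewrite invr_gt0 ltr0n.
have /vabsP[h1 h2] : vabs x <= 0 by rewrite x0.
by apply/eqP; rewrite eq_le h1 -vlat_leN2 oppr0.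
Qed.

(** Limits for the norm of [e] are unique. *)
Lemma archimedean_dist_eq e x y : archimedean_vlat X -> 0 <= e ->
  (forall eps : R, 0 < eps -> vabs (x - y) <= eps *: e) -> x = y.
Proof. by move=> hX e0 h; apply/subr0_eq; exact: archimedean_vabs_eq0 h. Qed.

Lemma vabs_sup_ge0 n (w : 'I_n -> X) : 0 <= vabs_sup w.
Proof.
apply: (big_ind (fun u => 0 <= u)) => [//|u v u0 _|i _]; last exact: vabs_ge0.
exact: le_trans u0 (leUl _ _).
Qed.

Lemma enorm_subC e x y : enorm e (x - y) = enorm e (y - x).
Proof. by rewrite /enorm vabs_subC. Qed.

Lemma enorm_le e x (l : R) : 0 <= l -> vabs x <= l *: e -> enorm e x <= l.
Proof.
move=> l0 h; apply: ge_inf => //.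
by exists 0 => r /= [].
Qed.

(** Membership in the order ideal is essential: outside it the infimum is
    that of the empty set and carries no information. *)
Lemma enorm_lt e x (l : R) : 0 <= e -> order_ideal e x ->
  enorm e x < l -> vabs x <= l *: e.
Proof.
move=> e0 [k [k0 kx]] /inf_lt[|r [r0 rx] rl]; first by exists k.
by apply: (le_trans rx); apply: vlat_scale_r => //; exact: ltW.
Qed.

End VectorLatticeTheory.

(** * Positivity of lattice-linear expressions *)

(** The one-variable case of linear programming: it supplies the value of the
    variable eliminated in one Fourier-Motzkin step. *)
Lemma exists_between (R : realFieldType) (L U : seq R) :
  (forall l u, l \in L -> u \in U -> l < u) ->
  exists r, (forall l, l \in L -> l < r) /\ (forall u, u \in U -> r < u).
Proof.
have above (l : R) : {in U, forall u, l < u} ->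
    exists2 r, l < r & {in U, forall u, r < u}.
  elim: U => [|u U IH] lU; first by exists (l + 1); [lra|].
  have [|r lr rU] := IH; first by move=> v vU; apply: lU; rewrite inE vU orbT.
  have lu : l < u by apply: lU; rewrite mem_head.
  exists (Num.min r ((l + u) / 2)); first by rewrite lt_min lr /=; lra.
  move=> v; rewrite inE gt_min => /orP[/eqP ->|/rU ->//].
  by apply/orP; right; lra.
elim: L => [|l L IH] LU.
  have [r0 r0U] : exists r, {in U, forall u, r < u}.
    elim: (U) => [|u V [r rV]]; first by exists 0.
    exists (Num.min r (u - 1)) => v; rewrite inE gt_min => /orP[/eqP ->|/rV ->//].
    by apply/orP; right; lra.
  by exists r0.
have [|r [Lr rU]] := IH.
  by move=> k u kL; apply: LU; rewrite inE kL orbT.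
have [|q lq qU] := above l.
  by move=> u; apply: LU; rewrite mem_head.
exists (Num.max r q); split=> [k|u uU]; last by rewrite gt_max rU ?qU.
rewrite inE lt_max => /orP[/eqP ->|/Lr ->//]; by rewrite lq orbT.
Qed.

(** By Gordan's theorem, if no [t] makes all the forms in [s] negative, then
    some nontrivial nonnegative combination of them vanishes; the same
    combination of the bounds [c *: z] is a positive multiple of [z], whence
    [0 <= z].  Eliminating the variables one by one performs this combination
    inside [X], without naming its coefficients. *)
Lemma fourier_motzkin (R : realType) (X : vectorLatticeType R) n
    (x : 'I_n -> X) (s : seq 'rV[R]_n) (z : X) :
  (forall t : 'rV[R]_n, exists2 a : 'rV[R]_n,
    a \in s & 0 <= \sum_i a 0 i * t 0 i) ->
  (forall a : 'rV[R]_n, a \in s ->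
    exists2 c : R, 0 < c & \sum_i a 0 i *: x i <= c *: z) ->
  0 <= z.
Proof.
elim: n x s => [|n IH] x s hpos hle.
  have [a /hle[c c0 +] _] := hpos 0; rewrite big_ord0 => h.
  have := vlat_scale (a := c^-1) _ h.
  rewrite scaler0 scalerA mulVf ?gt_eqF// scale1r; apply.
  by rewrite invr_ge0 ltW.
(* [comb a b] is the positive combination of [a] and [b], for a form [a] with
   positive and a form [b] with negative leading coefficient, that no longer
   contains the first variable. *)
pose tl (a : 'rV[R]_n.+1) : 'rV[R]_n := col' ord0 a.
pose comb (a b : 'rV[R]_n.+1) := a 0 ord0 *: tl b - b 0 ord0 *: tl a.
pose P := [seq a : 'rV[R]_n.+1 <- s | 0 < a 0 ord0].
pose N := [seq a : 'rV[R]_n.+1 <- s | a 0 ord0 < 0].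
pose Z := [seq a : 'rV[R]_n.+1 <- s | a 0 ord0 == 0].
apply: (IH (x \o lift ord0)
  ([seq tl a | a <- Z] ++ [seq comb a b | a <- P, b <- N])).
  move=> t; apply: contrapT => noneg.
  pose v (a : 'rV[R]_n.+1) := \sum_i a 0 (lift ord0 i) * t 0 i.
  have hZ a : a \in s -> a 0 ord0 = 0 -> v a < 0.
    move=> sa a0; rewrite ltNge; apply/negP => va; apply: noneg.
    exists (tl a); last by under eq_bigr do rewrite mxE.
    by rewrite mem_cat map_f// mem_filter sa a0 eqxx.
  have hPN a b : a \in s -> b \in s -> 0 < a 0 ord0 -> b 0 ord0 < 0 ->
      a 0 ord0 * v b - b 0 ord0 * v a < 0.
    move=> sa sb a0 b0; rewrite ltNge; apply/negP => vab; apply: noneg.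
    exists (comb a b).
      by rewrite mem_cat allpairs_f ?orbT// mem_filter ?a0 ?b0.
    rewrite (le_trans vab)// /v !mulr_sumr -sumrB le_eqVlt; apply/orP; left.
    by apply/eqP/eq_bigr => i _; rewrite !mxE; ring.
  (* A form is negative at (r, t) iff [r] lies strictly on one side of its
     bound: below if its leading coefficient is positive, above if it is
     negative. *)
  pose bound (a : 'rV[R]_n.+1) := - v a / a 0 ord0.
  have [|r [rN rP]] := @exists_between R (map bound N) (map bound P).
    move=> _ _ /mapP[b + ->] /mapP[a + ->]; rewrite !mem_filter.
    move=> /andP[b0 sb] /andP[a0 sa]; rewrite /bound ltr_pdivlMr//.
    rewrite mulrAC ltr_ndivrMr//; have := hPN a b sa sb a0 b0; nra.
  have [a sa] := hpos (\row_i oapp (t 0) r (unlift ord0 i)).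
  rewrite big_ord_recl !mxE unlift_none /=.
  under eq_bigr do rewrite mxE liftK /=.
  rewrite -/(v a) leNgt => /negP; apply.
  have [a0|a0|a0] := ltgtP (a 0 ord0) 0.
  - have : bound a < r by apply: rN; rewrite map_f// mem_filter a0.
    by rewrite /bound ltr_ndivrMr// => h; lra.
  - have : r < bound a by apply: rP; rewrite map_f// mem_filter a0.
    by rewrite /bound ltr_pdivlMr// => h; lra.
  - by rewrite a0 mul0r add0r hZ.
have tlE (a : 'rV[R]_n.+1) : \sum_i a 0 i *: x i =
    a 0 ord0 *: x ord0 + \sum_i tl a 0 i *: (x \o lift ord0) i.
  by rewrite big_ord_recl; congr (_ + _); apply: eq_bigr => i _; rewrite mxE.
move=> a; rewrite mem_cat => /orP[/mapP[b + ->]|/allpairsP[[b c] /=]].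
  rewrite mem_filter => /andP[/eqP b0 /hle[k k0]].
  by rewrite tlE b0 scale0r add0r => h; exists k.
rewrite !mem_filter => -[/andP[b0 /hle[k k0 hk]] /andP[c0 /hle[l l0 hl]] ->].
exists (b 0 ord0 * l - c 0 ord0 * k); first by nra.
have -> : \sum_i comb b c 0 i *: (x \o lift ord0) i =
    b 0 ord0 *: (\sum_i c 0 i *: x i) + (- c 0 ord0) *: \sum_i b 0 i *: x i.
  rewrite !tlE !scalerDr addrACA !scalerA mulNr mulrC -scalerDl subrr scale0r.
  rewrite add0r !scaler_sumr -big_split; apply: eq_bigr => i _ /=.
  by rewrite !mxE !scalerA -scalerDl mulNr.
rewrite scalerBl -!scalerA -scaleNr; apply: vlat_leD; apply: vlat_scale => //.
  exact: ltW.
by rewrite oppr_ge0 ltW.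
Qed.

(** * Positively homogeneous functions as a vector lattice *)

(** Naming the vector lattice makes its operations the abstract ones of a vector
    lattice, to which the lemmas above apply syntactically; the pointwise
    operations are obtained from them by unfolding, which is done once in the
    evaluation lemmas below. *)
Definition ph_lattice (R : realType) n : vectorLatticeType R := phfun R n.

Definition ph_unit (R : realType) n : ph_lattice R n :=
  vabs_sup (fun i => phfun_proj R i : ph_lattice R n).

Definition ph_val (R : realType) n (f : ph_lattice R n) (t : 'rV[R]_n) : R :=
  (f : phfun R n) t.

Section PhLattice.
Variables (R : realType) (n : nat).
Implicit Types (f g : ph_lattice R n) (t : 'rV[R]_n).

Lemma ph_leP f g : reflect (forall t, ph_val f t <= ph_val g t) (f <= g).
Proof. exact: phfun_leP. Qed.

Lemma ph_valD f g t : ph_val (f + g) t = ph_val f t + ph_val g t.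
Proof. by []. Qed.

Lemma ph_valN f t : ph_val (- f) t = - ph_val f t.
Proof. by []. Qed.

Lemma ph_valZ (c : R) f t : ph_val (c *: f) t = c * ph_val f t.
Proof. by []. Qed.

Lemma ph_valU f g t : ph_val (f `|` g)%O t = Num.max (ph_val f t) (ph_val g t).
Proof. exact: phfun_joinE. Qed.

Lemma ph_valI f g t : ph_val (f `&` g)%O t = Num.min (ph_val f t) (ph_val g t).
Proof. exact: phfun_meetE. Qed.

Lemma ph_val_abs f t : ph_val (vabs f) t = `|ph_val f t|.
Proof.
rewrite ph_valU ph_valN; have [h|h] := leP 0 (ph_val f t).
  by rewrite ger0_norm// max_l//; lra.
by rewrite ltr0_norm// max_r//; lra.
Qed.

Lemma ph_val_homo f (l : R) t : 0 <= l -> ph_val f (l *: t) = l * ph_val f t.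
Proof. by have /asboolP[hf _] := phfun_funP f; exact: hf. Qed.

Lemma ph_val_continuous f : continuous (ph_val f).
Proof. by have /asboolP[_ cf] := phfun_funP f. Qed.

End PhLattice.

(** * Lattice-linear expressions in the projections and in the x_i *)

Section LatticeLinear.
Variables (R : realType) (X : vectorLatticeType R) (n : nat) (x : 'I_n -> X).
Implicit Types (f g u v : ph_lattice R n) (y z : X) (a b : 'rV[R]_n).

(** The sublattice of the product of the two vector lattices generated by the
    pairs of corresponding generators.  That it is the graph of a map is a
    consequence of its monotonicity, proved below. *)
Inductive lattice_linear : ph_lattice R n -> X -> Prop :=
| LatticeLinear0 : lattice_linear 0 0
| LatticeLinearProj i : lattice_linear (phfun_proj R i) (x i)
| LatticeLinearLin (c : R) f y g z : lattice_linear f y ->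
    lattice_linear g z -> lattice_linear (c *: f + g) (c *: y + z)
| LatticeLinearJoin f y g z : lattice_linear f y ->
    lattice_linear g z -> lattice_linear (f `|` g)%O (y `|` z)%O
| LatticeLinearMeet f y g z : lattice_linear f y ->
    lattice_linear g z -> lattice_linear (f `&` g)%O (y `&` z)%O.

Let dot a (t : 'rV[R]_n) : R := \sum_i a 0 i * t 0 i.
Let lin a : X := \sum_i a 0 i *: x i.

Let dotD a b t : dot (a + b) t = dot a t + dot b t.
Proof. by rewrite -big_split; apply: eq_bigr => i _; rewrite mxE mulrDl. Qed.

Let dotZ (c : R) a t : dot (c *: a) t = c * dot a t.
Proof. by rewrite mulr_sumr; apply: eq_bigr => i _; rewrite mxE mulrA. Qed.

Let linD a b : lin (a + b) = lin a + lin b.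
Proof. by rewrite -big_split; apply: eq_bigr => i _; rewrite mxE scalerDl. Qed.

Let linZ (c : R) a : lin (c *: a) = c *: lin a.
Proof. by rewrite scaler_sumr; apply: eq_bigr => i _; rewrite mxE scalerA. Qed.

(** Suprema of [s] are described through their upper bounds, so that sums,
    multiples and joins are computed by the adjunction properties of the order,
    with the same list serving the real values and the elements of [X]. *)
Definition finite_sup (s : seq 'rV[R]_n) f y :=
  (forall t (r : R), (ph_val f t <= r) = all (fun a => dot a t <= r) s) /\
  (forall z, (y <= z) = all (fun a => lin a <= z) s).

Lemma finite_sup1 a f y : (forall t, ph_val f t = dot a t) -> y = lin a ->
  finite_sup [:: a] f y.
Proof. by move=> fE ->; split=> [t r|z] /=; rewrite andbT ?fE. Qed.

Lemma finite_supD s1 s2 f y g z : finite_sup s1 f y -> finite_sup s2 g z ->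
  finite_sup [seq a + b | a <- s1, b <- s2] (f + g) (y + z).
Proof.
move=> [fs ys] [gs zs]; split=> [t r|w].
  rewrite ph_valD -[LHS]lerBrDr fs.
  apply/allP/all_allpairsP => [h a b /h as1 bs2 |h a as1].
    rewrite dotD -lerBrDl; move: b bs2; apply/allP; rewrite -gs.
    by rewrite lerBrDl -lerBrDr.
  rewrite lerBrDr -lerBrDl gs; apply/allP => b bs2.
  by rewrite lerBrDl -dotD; exact: h.
rewrite -vlat_leBrDr ys.
apply/allP/all_allpairsP => [h a b /h as1 bs2|h a as1].
  rewrite linD addrC -vlat_leBrDr; move: b bs2; apply/allP; rewrite -zs.
  by rewrite vlat_leBrDr addrC -vlat_leBrDr.
rewrite vlat_leBrDr addrC -vlat_leBrDr zs; apply/allP => b bs2.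
by rewrite vlat_leBrDr addrC -linD; exact: h.
Qed.

Lemma finite_supZ (c : R) s f y : 0 < c -> finite_sup s f y ->
  finite_sup [seq c *: a | a <- s] (c *: f) (c *: y).
Proof.
move=> c0 [fs ys]; split=> [t r|w]; rewrite all_map.
  rewrite ph_valZ -ler_pdivlMl// fs; apply: eq_all => a /=.
  by rewrite dotZ ler_pdivlMl.
by rewrite vlat_scale_pos// ys; apply: eq_all => a /=; rewrite linZ vlat_scale_pos.
Qed.

Lemma finite_supU s1 s2 f y g z : finite_sup s1 f y -> finite_sup s2 g z ->
  finite_sup (s1 ++ s2) (f `|` g)%O (y `|` z)%O.
Proof.
move=> [fs ys] [gs zs]; split=> [t r|w]; rewrite all_cat.
  by rewrite ph_valU ge_max fs gs.
by rewrite leUx ys zs.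
Qed.

(** If [f <= g], each linear form [b] of [f] satisfies [b <= max s2] at every
    point, so the forms [a - b] have a nonnegative maximum; elimination then
    gives [lin b <= z]. *)
Lemma finite_sup_le s1 s2 f y g z : finite_sup s1 f y -> finite_sup s2 g z ->
  f <= g -> y <= z.
Proof.
move=> [fs ys] [gs zs] /ph_leP fg; rewrite ys; apply/allP => b bs1.
rewrite -vlat_subr_ge0.
apply: (@fourier_motzkin R X n x [seq a - b | a <- s2]) => [t|_ /mapP[a as2 ->]].
  apply: contrapT => noneg.
  have [|r [s2r rb]] := @exists_between R [seq dot a t | a <- s2] [:: dot b t].
    move=> _ _ /mapP[a as2 ->] /[!inE] /eqP ->; rewrite ltNge; apply/negP => ba.
    apply: noneg; exists (a - b); first exact: (map_f (fun a => a - b)).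
    by rewrite -/(dot _ _) dotD -scaleN1r dotZ mulN1r subr_ge0.
  have : ph_val g t <= r by rewrite gs; apply/allP => a as2; apply/ltW/s2r/map_f.
  have /allP/(_ _ bs1) : all (fun a => dot a t <= ph_val f t) s1 by rewrite -fs.
  by have := fg t; have := rb _ (mem_head _ _); lra.
exists 1 => //; rewrite -/(lin _) linD -scaleN1r linZ scaleN1r scale1r.
by rewrite vlat_leD2r; move: a as2; apply/allP; rewrite -zs.
Qed.

(** Differences of finite suprema form a sublattice because
    (a - a') \/ (b - b') = ((a + b') \/ (b + a')) - (a' + b'). *)
Definition sup_difference f y := exists s1 s2 u (v : X) u' (v' : X),
  [/\ finite_sup s1 u v, finite_sup s2 u' v', f = u - u' & y = v - v'].

Let finite_sup0 : finite_sup [:: 0] 0 0.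
Proof.
apply: finite_sup1 => [t|]; first by rewrite -(scale0r (0 : 'rV[R]_n)) dotZ mul0r.
by rewrite -[in RHS](scale0r (0 : 'rV[R]_n)) linZ scale0r.
Qed.

Let sup_difference0 : sup_difference 0 0.
Proof. by exists [:: 0], [:: 0], 0, 0, 0, 0; rewrite !subr0. Qed.

Let sup_difference1 a f y : (forall t, ph_val f t = dot a t) -> y = lin a ->
  sup_difference f y.
Proof.
move=> fE yE; exists [:: a], [:: 0], f, y, 0, 0; rewrite !subr0.
by split=> //; exact: finite_sup1.
Qed.

Let sup_differenceD f y g z : sup_difference f y -> sup_difference g z ->
  sup_difference (f + g) (y + z).
Proof.
move=> [s1 [s2 [u [v [u' [v' [h1 h2 -> ->]]]]]]].
move=> [s3 [s4 [w [q [w' [q' [h3 h4 -> ->]]]]]]].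
do 6 eexists; split; [exact: finite_supD h1 h3|exact: finite_supD h2 h4|..];
  by rewrite opprD addrACA.
Qed.

Let sup_differenceN f y : sup_difference f y -> sup_difference (- f) (- y).
Proof.
move=> [s1 [s2 [u [v [u' [v' [h1 h2 -> ->]]]]]]].
by exists s2, s1, u', v', u, v; rewrite !opprB.
Qed.

Let sup_differenceZ (c : R) f y : sup_difference f y ->
  sup_difference (c *: f) (c *: y).
Proof.
move=> [s1 [s2 [u [v [u' [v' [h1 h2 -> ->]]]]]]].
have pos (d : R) : 0 < d -> sup_difference (d *: (u - u')) (d *: (v - v')).
  move=> d0; do 6 eexists; split.
  - exact: finite_supZ d0 h1.
  - exact: finite_supZ d0 h2.
  - exact: scalerBr.
  - exact: scalerBr.
have [c0|c0|<-] := ltgtP 0 c; [exact: pos| |]; last first.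
  rewrite !scale0r; exact: sup_difference0.
rewrite -[c]opprK (scaleNr _ (u - u')) (scaleNr _ (v - v')).
by apply/sup_differenceN/pos; rewrite oppr_gt0.
Qed.

Let sup_differenceU f y g z : sup_difference f y -> sup_difference g z ->
  sup_difference (f `|` g)%O (y `|` z)%O.
Proof.
move=> [s1 [s2 [u [v [u' [v' [h1 h2 -> ->]]]]]]].
move=> [s3 [s4 [w [q [w' [q' [h3 h4 -> ->]]]]]]].
have joinB (Y : vectorLatticeType R) (a a' b b' : Y) :
    ((a - a') `|` (b - b') = ((a + b') `|` (b + a')) - (a' + b'))%O.
  by rewrite vlat_joinDr opprD addrACA subrr addr0 addrA addrK.
do 6 eexists; split.
- exact: finite_supU (finite_supD h1 h4) (finite_supD h3 h2).
- exact: finite_supD h2 h4.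
- exact: joinB.
- exact: joinB.
Qed.

Lemma lattice_linear_sup_difference f y :
  lattice_linear f y -> sup_difference f y.
Proof.
elim=> [|i|c {}f {}y g z _ IHf _ IHg|{}f {}y g z _ IHf _ IHg
  |{}f {}y g z _ IHf _ IHg].
- exact: sup_difference0.
- apply: (@sup_difference1 (delta_mx 0 i)) => [t|].
    rewrite /dot (bigD1 i)//= big1 ?mxE ?eqxx ?mul1r ?addr0// => j ji.
    by rewrite mxE (negbTE ji) mul0r.
  rewrite /lin (bigD1 i)//= big1 ?mxE ?eqxx ?scale1r ?addr0// => j ji.
  by rewrite mxE (negbTE ji) scale0r.
- by apply: sup_differenceD => //; exact: sup_differenceZ.
- exact: sup_differenceU.
- by rewrite !vlat_meetN; apply/sup_differenceN/sup_differenceU; exact: sup_differenceN.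
Qed.

Lemma lattice_linear_ge0 f y : lattice_linear f y -> 0 <= f -> 0 <= y.
Proof.
move=> /lattice_linear_sup_difference[s1 [s2 [u [v [u' [v' [h1 h2 -> ->]]]]]]].
move=> f0; rewrite vlat_subr_ge0; apply: finite_sup_le h2 h1 _.
by rewrite -vlat_subr_ge0.
Qed.

Lemma lattice_linear_le f y g z : lattice_linear f y -> lattice_linear g z ->
  f <= g -> y <= z.
Proof.
move=> hf hg fg; rewrite -vlat_subr_ge0.
have := LatticeLinearLin (-1) hf hg; rewrite !scaleN1r addrC [- y + _]addrC.
by move=> /lattice_linear_ge0; apply; rewrite vlat_subr_ge0.
Qed.

Lemma lattice_linear_abs f y :
  lattice_linear f y -> lattice_linear (vabs f) (vabs y).
Proof.
move=> h; apply: LatticeLinearJoin => //.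
by have := LatticeLinearLin (-1) h LatticeLinear0; rewrite !scaleN1r !addr0.
Qed.

Lemma lattice_linear_abs_sup : lattice_linear (ph_unit R n) (vabs_sup x).
Proof.
apply: (big_ind2 lattice_linear); first exact: LatticeLinear0.
  by move=> *; exact: LatticeLinearJoin.
by move=> i _; exact/lattice_linear_abs/LatticeLinearProj.
Qed.

Lemma lattice_linear_dist_le f y g z (c : R) :
  lattice_linear f y -> lattice_linear g z ->
  vabs (f - g) <= c *: ph_unit R n -> vabs (y - z) <= c *: vabs_sup x.
Proof.
move=> hf hg; apply: lattice_linear_le.
  apply: lattice_linear_abs.
  have := LatticeLinearLin (-1) hg hf.
  by rewrite !scaleN1r addrC [- z + y]addrC.
have := LatticeLinearLin c lattice_linear_abs_sup LatticeLinear0.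
by rewrite !addr0.
Qed.

End LatticeLinear.

(** * Density of lattice-linear functions *)

(** A property inherited by subsets and finite unions and true near each point
    of a compact set holds for that set: otherwise the complements of the sets
    having the property generate a proper filter without cluster point. *)
Lemma compact_induction (T : topologicalType) (K : set T) (P : set T -> Prop) :
  compact K -> P set0 ->
  (forall A B, A `<=` B -> P B -> P A) ->
  (forall A B, P A -> P B -> P (A `|` B)) ->
  (forall t, K t -> exists2 U, nbhs t U & P U) -> P K.
Proof.
move=> cK P0 Psub PU Ploc; apply: contrapT => PK.
pose F : set_system T := [set A | P (K `\` A)].
have FF : ProperFilter F.
  apply: Build_ProperFilter_ex => [A|].
    move=> FA; apply: contrapT => A0; apply: PK; apply: Psub FA => t Kt.
    by split=> // At; apply: A0; exists t.
  split=> [|A B FA FB|A B AB].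
  - by rewrite /F /= setDT.
  - by rewrite /F /= setDIr; exact: PU.
  - by apply: Psub => t [Kt nBt]; split=> // /AB.
have [|t [Kt tF]] := cK F FF; first by rewrite /F /= setDv.
have [U tU PU'] := Ploc t Kt.
have [|s [nUs Us]] := tF (~` U) U _ tU; last exact: nUs.
by apply: Psub PU' => s [_ /= /contrapT].
Qed.

Section Density.
Variables (R : realType) (n : nat).
Implicit Types (f g : ph_lattice R n) (s t : 'rV[R]_n).

Let e0 := ph_unit R n.

Lemma ph_unit_ge0 t : 0 <= ph_val e0 t.
Proof.
by have /ph_leP/(_ t) : 0 <= e0 by exact: vabs_sup_ge0.
Qed.

Lemma ph_unit_coord t i : `|t ord0 i| <= ph_val e0 t.
Proof.
have n0 : (0 < n)%N by exact: leq_ltn_trans (ltn_ord i).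
have : e0 <= e0 by [].
move=> /(vabs_supP (fun i => phfun_proj R i : ph_lattice R n) e0 n0)/(_ i).
by move=> /ph_leP/(_ t); rewrite ph_val_abs.
Qed.

Lemma ph_unit_eq0 t : ph_val e0 t = 0 -> t = 0.
Proof.
move=> t0; apply/rowP => i; rewrite mxE; apply/eqP; rewrite -normr_le0 -t0.
exact: ph_unit_coord.
Qed.

Lemma ph_val_near f t (eps : R) : 0 < eps ->
  nbhs t [set s | `|ph_val f t - ph_val f s| < eps].
Proof.
move=> eps0; have := @ph_val_continuous _ _ f t (ball (ph_val f t) eps).
by apply; exact: nbhsx_ballx.
Qed.

Definition ph_sphere : set 'rV[R]_n := [set t | ph_val e0 t = 1].

Lemma compact_ph_sphere : compact ph_sphere.
Proof.
apply: (@subclosed_compact _ _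
  [set t : 'rV[R]_n | forall i, `[(-1 : R), 1]%classic (t ord0 i)]).
- apply: (@closed_comp _ _ (ph_val e0) [set 1]); last exact: closed_eq.
  by move=> t _; exact: ph_val_continuous.
- apply: (@rV_compact _ _ (fun=> `[(-1 : R), 1]%classic)) => _.
  exact: segment_compact.
- by move=> t t1 i; rewrite /= in_itv /= -ler_norml -t1 ph_unit_coord.
Qed.

(** Homogeneity reduces inequalities to the sphere; away from it only the
    origin remains, where every function vanishes. *)
Lemma ph_le_sphere f g :
  (forall t, ph_sphere t -> ph_val f t <= ph_val g t) -> f <= g.
Proof.
move=> fg; apply/ph_leP => t; have [/ph_unit_eq0 ->|t0] := eqVneq (ph_val e0 t) 0.
  by rewrite -(scale0r (0 : 'rV[R]_n)) !ph_val_homo// !mul0r.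
have tE : t = ph_val e0 t *: ((ph_val e0 t)^-1 *: t).
  by rewrite scalerA mulfV// scale1r.
rewrite tE !(ph_val_homo _ _ (ph_unit_ge0 t)) ler_wpM2l ?ph_unit_ge0// fg//.
by rewrite /ph_sphere /= ph_val_homo ?invr_ge0 ?ph_unit_ge0// mulVf.
Qed.

Lemma ph_unit_bound f : exists2 M : R, 0 <= M & vabs f <= M *: e0.
Proof.
have [M M0 fM] : exists2 M : R, 0 <= M &
    forall t, ph_sphere t -> `|ph_val f t| <= M.
  apply: (compact_induction (P := fun A => exists2 M : R, 0 <= M &
    forall t, A t -> `|ph_val f t| <= M)); first exact: compact_ph_sphere.
  - by exists 0.
  - by move=> A B AB [M M0 h]; exists M => // t /AB/h.
  - move=> A B [M M0 hA] [N N0 hB]; exists (M + N); first exact: addr_ge0.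
    move=> t [/hA|/hB] h; apply: (le_trans h); lra.
  - move=> t _; exists [set s | `|ph_val f t - ph_val f s| < 1].
      exact: ph_val_near.
    exists (`|ph_val f t| + 1); first by rewrite addr_ge0.
    move=> s /= h; have := ler_normD (ph_val f s - ph_val f t) (ph_val f t).
    by rewrite subrK distrC; lra.
exists M => //; apply: ph_le_sphere => t t1.
by rewrite ph_val_abs ph_valZ t1 mulr1 fM.
Qed.

Variables (X : vectorLatticeType R) (x : 'I_n -> X).
Local Notation LL := (lattice_linear x).

Lemma lattice_linear_unitZ (c : R) : exists y, LL (c *: e0) y.
Proof.
have := LatticeLinearLin c (lattice_linear_abs_sup x) (LatticeLinear0 x).
by rewrite addr0; eexists; eassumption.
Qed.

(** Since [ph_unit] is 1 on the sphere, the affine function of a coordinate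
    separating [s] from [t] that takes the prescribed values is the restriction
    of a linear combination of that projection and [ph_unit]. *)
Lemma lattice_linear_interpolation (a b : R) s t :
  ph_sphere s -> ph_sphere t -> (s = t -> a = b) ->
  exists g y, [/\ LL g y, ph_val g s = a & ph_val g t = b].
Proof.
move=> s1 t1 ab; have [st|] := eqVneq s t.
  have [y hy] := lattice_linear_unitZ a; exists (a *: e0), y.
  by rewrite !ph_valZ s1 t1 mulr1 -ab.
move=> /eqP st; have [i sti] : exists i, s ord0 i != t ord0 i.
  apply: contrapT => h; apply: st; apply/rowP => i; apply/eqP.
  by apply: contrapT => /negP sti; apply: h; exists i.
pose c := (a - b) / (s ord0 i - t ord0 i).
have [y hy] := lattice_linear_unitZ (b - c * t ord0 i).
exists (c *: (phfun_proj R i : ph_lattice R n) + (b - c * t ord0 i) *: e0),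
  (c *: x i + y).
split; first exact/LatticeLinearLin/hy/LatticeLinearProj.
  rewrite ph_valD !ph_valZ s1 mulr1 -[ph_val (phfun_proj R i) s]/(s ord0 i) /c.
  by field; rewrite subr_eq0.
rewrite ph_valD !ph_valZ t1 mulr1 -[ph_val (phfun_proj R i) t]/(t ord0 i).
by ring.
Qed.

(** The lattice form of the Stone-Weierstrass argument: for fixed [s], a finite
    meet of functions interpolating [f] at [s] and at another point stays below
    [f + eps]; a finite join of those meets over varying [s] also exceeds
    [f - eps]. *)
Lemma lattice_linear_dense f (eps : R) : 0 < eps ->
  exists g y, LL g y /\ vabs (f - g) <= eps *: e0.
Proof.
move=> eps0; have eps20 : 0 < eps / 2 by rewrite divr_gt0.
have [M M0 fM] := ph_unit_bound f.
have fMs t : ph_sphere t -> `|ph_val f t| <= M.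
  by move=> t1; move/ph_leP/(_ t): fM; rewrite ph_val_abs ph_valZ t1 mulr1.
have above s : ph_sphere s -> exists g y, [/\ LL g y, ph_val f s <= ph_val g s &
    forall t, ph_sphere t -> ph_val g t < ph_val f t + eps].
  move=> s1.
  apply: (compact_induction (P := fun A => exists g y,
    [/\ LL g y, ph_val f s <= ph_val g s &
    forall t, A t -> ph_val g t < ph_val f t + eps])); first exact: compact_ph_sphere.
  - have [y hy] := lattice_linear_unitZ (ph_val f s).
    by exists (ph_val f s *: e0), y; rewrite ph_valZ s1 mulr1.
  - by move=> A B AB [g [y [h1 h2 h3]]]; exists g, y; split=> // t /AB/h3.
  - move=> A B [g1 [y1 [h1 h2 h3]]] [g2 [y2 [h4 h5 h6]]].
    exists (g1 `&` g2)%O, (y1 `&` y2)%O; split; first exact: LatticeLinearMeet.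
      by rewrite ph_valI le_min h2.
    by move=> t [/h3|/h6] h; rewrite ph_valI gt_min h ?orbT.
  - move=> t t1; have [|g [y [hg gs gt]]] :=
      @lattice_linear_interpolation (ph_val f s) (ph_val f t) s t s1 t1.
      by move=> ->.
    exists ([set r | `|ph_val f t - ph_val f r| < eps / 2] `&`
            [set r | `|ph_val g t - ph_val g r| < eps / 2]).
      by apply: filterI; exact: ph_val_near.
    exists g, y; split=> [//||r [/= h1 h2]]; first by rewrite gs.
    by move: h1 h2; rewrite !ltr_norml gt => /andP[? ?] /andP[? ?]; lra.
have [g [y [hg gu gl]]] : exists g y, [/\ LL g y,
    forall t, ph_sphere t -> ph_val g t < ph_val f t + eps &
    forall t, ph_sphere t -> ph_val f t - eps < ph_val g t].
  apply: (compact_induction (P := fun A => exists g y, [/\ LL g y,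
    forall t, ph_sphere t -> ph_val g t < ph_val f t + eps &
    forall t, A t -> ph_val f t - eps < ph_val g t])); first exact: compact_ph_sphere.
  - have [y hy] := lattice_linear_unitZ (- M); exists ((- M) *: e0), y.
    split=> // t t1; rewrite ph_valZ t1 mulr1.
    by have := fMs t t1; rewrite ler_norml => /andP[? ?]; lra.
  - by move=> A B AB [g [y [h1 h2 h3]]]; exists g, y; split=> // t /AB/h3.
  - move=> A B [g1 [y1 [h1 h2 h3]]] [g2 [y2 [h4 h5 h6]]].
    exists (g1 `|` g2)%O, (y1 `|` y2)%O; split; first exact: LatticeLinearJoin.
      by move=> t t1; rewrite ph_valU gt_max h2// h5.
    by move=> t [/h3|/h6] h; rewrite ph_valU lt_max h ?orbT.
  - move=> s s1; have [g [y [hg gs gt]]] := above s s1.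
    exists ([set r | `|ph_val f s - ph_val f r| < eps / 2] `&`
            [set r | `|ph_val g s - ph_val g r| < eps / 2]).
      by apply: filterI; exact: ph_val_near.
    exists g, y; split=> [//|//|r [/= h1 h2]].
    by move: h1 h2; rewrite !ltr_norml => /andP[? ?] /andP[? ?]; lra.
exists g, y; split; first exact: hg.
apply: ph_le_sphere => t t1.
rewrite ph_val_abs ph_valZ t1 mulr1 ph_valD ph_valN ler_norml.
by have := gu t t1; have := gl t t1; move=> ? ?; apply/andP; split; lra.
Qed.

End Density.

(** * Extending lattice-linear expressions to continuous functions *)

Section Extension.
Variables (R : realType) (X : vectorLatticeType R) (n : nat) (x : 'I_n -> X).
Variable e : X.
Hypotheses (hX : archimedean_vlat X) (xe : vabs_sup x <= e).
Implicit Types (f g : ph_lattice R n) (y z : X).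
Local Notation LL := (lattice_linear x).
Let e0 := ph_unit R n.

Let e_ge0 : 0 <= e. Proof. exact: le_trans (vabs_sup_ge0 _) xe. Qed.

Let e0_ge0 : 0 <= e0. Proof. exact: vabs_sup_ge0. Qed.

(** The closure of [lattice_linear] in the product, for the norms of [ph_unit]
    and of [e]; it is the graph of the homomorphism to be constructed. *)
Definition approximable f y := forall eps : R, 0 < eps -> exists g z,
  [/\ LL g z, vabs (f - g) <= eps *: e0 & vabs (y - z) <= eps *: e].

Lemma lattice_linear_approximable f y : LL f y -> approximable f y.
Proof.
move=> h eps eps0; exists f, y.
by rewrite !subrr /vabs !oppr0 !joinxx; split=> //; apply: vscale_ge0 => //; exact: ltW.
Qed.

Lemma lattice_linear_dist g z g' z' (c : R) : 0 <= c -> LL g z -> LL g' z' ->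
  vabs (g - g') <= c *: e0 -> vabs (z - z') <= c *: e.
Proof.
move=> c0 h h' gg'; apply: le_trans (lattice_linear_dist_le h h' gg') _.
exact: vlat_scale.
Qed.

Lemma approximable_uniq f y y' : approximable f y -> approximable f y' -> y = y'.
Proof.
move=> hy hy'; apply: (archimedean_dist_eq hX e_ge0) => eps eps0.
have d0 : 0 < eps / 4 by rewrite divr_gt0.
have [g [z [h1 h2 h3]]] := hy _ d0; have [g' [z' [h4 h5 h6]]] := hy' _ d0.
have -> : eps = eps / 4 + (eps / 4 + eps / 4) + eps / 4 by lra.
rewrite vabs_subC in h2; rewrite vabs_subC in h6.
rewrite 2!scalerDl; apply: vabs_dist_trans h6; apply: vabs_dist_trans h3 _.
apply: lattice_linear_dist h1 h4 _; first by rewrite addr_ge0 ?ltW.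
by rewrite scalerDl; exact: vabs_dist_trans h2 h5.
Qed.

Lemma approximable_lin (c : R) f y f' y' : approximable f y ->
  approximable f' y' -> approximable (c *: f + f') (c *: y + y').
Proof.
move=> hy hy' eps eps0; have c1 : 0 < `|c| + 1 by rewrite ltr_wpDl.
pose d := eps / (`|c| + 1).
have d0 : 0 < d by rewrite divr_gt0.
have dE : eps = `|c| * d + d by rewrite /d; field; rewrite gt_eqF.
have [g [z [h1 h2 h3]]] := hy _ d0; have [g' [z' [h4 h5 h6]]] := hy' _ d0.
exists (c *: g + g'), (c *: z + z'); split; first exact: LatticeLinearLin.
  by rewrite dE scalerDl -scalerA; exact: vabs_dist_lin.
by rewrite dE scalerDl -scalerA; exact: vabs_dist_lin.
Qed.

Lemma approximable_join f y f' y' : approximable f y -> approximable f' y' ->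
  approximable (f `|` f')%O (y `|` y')%O.
Proof.
move=> hy hy' eps eps0.
have [g [z [h1 h2 h3]]] := hy _ eps0; have [g' [z' [h4 h5 h6]]] := hy' _ eps0.
exists (g `|` g')%O, (z `|` z')%O.
by split; [exact: LatticeLinearJoin|exact: vabs_dist_join|exact: vabs_dist_join].
Qed.

Lemma approximable_meet f y f' y' : approximable f y -> approximable f' y' ->
  approximable (f `&` f')%O (y `&` y')%O.
Proof.
move=> hy hy' eps eps0.
have [g [z [h1 h2 h3]]] := hy _ eps0; have [g' [z' [h4 h5 h6]]] := hy' _ eps0.
exists (g `&` g')%O, (z `&` z')%O.
by split; [exact: LatticeLinearMeet|exact: vabs_dist_meet|exact: vabs_dist_meet].
Qed.

Let C := closed_sublattice_gen e x.

Lemma lattice_linear_mem_gen f y : LL f y -> C y.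
Proof.
move=> h S [[_ [S0 SL SU SI] _] xS]; elim: h => //.
- by move=> i; apply: xS; exists i.
- by move=> c f1 y1 g1 z1 _ h1 _ h2; exact: SL.
- by move=> f1 y1 g1 z1 _ h1 _ h2; exact: SU.
- by move=> f1 y1 g1 z1 _ h1 _ h2; exact: SI.
Qed.

Lemma order_idealB y z : order_ideal e y -> order_ideal e z -> order_ideal e (y - z).
Proof.
have [_ [_ hl _ _] _] := order_ideal_closed e_ge0 => hy hz.
by have := hl (-1) z y hz hy; rewrite scaleN1r addrC.
Qed.

Lemma gen_sub_order_ideal : (0 < n)%N -> C `<=` order_ideal e.
Proof.
move=> n0; have [] // := @closed_sublattice_gen_closed _ _ e n x e_ge0 _.
exact/vabs_supP.
Qed.

(** The images of lattice-linear functions converging to [f] form a Cauchy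
    sequence by monotonicity of [lattice_linear]; its limit is the value. *)
Lemma approximable_total : (0 < n)%N -> enorm_complete_on e C ->
  forall f, exists y, approximable f y.
Proof.
move=> n0 hC f; have CI := gen_sub_order_ideal n0.
have /choice[z hz] (k : nat) : exists z, exists g,
    LL g z /\ vabs (f - g) <= k.+1%:R^-1 *: e0.
  have [|g [z h]] := @lattice_linear_dense R n X x f k.+1%:R^-1.
    by rewrite invr_gt0.
  by exists z, g.
have zC k : C (z k) by have [g [/lattice_linear_mem_gen]] := hz k.
have zB (d : R) N k l : (N <= k)%N -> (N <= l)%N -> N.+1%:R^-1 <= d ->
    vabs (z k - z l) <= (d + d) *: e.
  move=> Nk Nl Nd; have d0 : 0 <= d by apply: le_trans Nd; rewrite invr_ge0.
  have [g [hg fg]] := hz k; have [g' [hg' fg']] := hz l.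
  apply: lattice_linear_dist hg hg' _; first exact: addr_ge0.
  have le_d m : (N <= m)%N -> (m.+1%:R^-1 : R) <= d.
    by move=> Nm; apply: le_trans Nd; rewrite lef_pV2 ?posrE// ler_nat.
  rewrite scalerDl; apply: (@vabs_dist_trans _ _ f).
    rewrite vabs_subC; apply: le_trans fg _.
    by apply: vlat_scale_r; [exact: e0_ge0|exact: le_d].
  by apply: le_trans fg' _; apply: vlat_scale_r; [exact: e0_ge0|exact: le_d].
have small (eps : R) : 0 < eps -> exists N, N.+1%:R^-1 < eps.
  by move=> /ltr_add_invr[k]; rewrite add0r; exists k.
have [eps eps0|y Cy zy] := hC z zC.
  have [|N Neps] := small (eps / 4); first by rewrite divr_gt0.
  exists N => k l Nk Nl; apply: (@le_lt_trans _ _ (eps / 4 + eps / 4)); last by lra.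
  apply: enorm_le; first by lra.
  by apply: zB Nk Nl _; exact: ltW.
exists y => eps eps0.
have [N hN] := zy _ eps0; have [M hM] := small _ eps0.
have [g [hg fg]] := hz (maxn N M); exists g, (z (maxn N M)); split.
- exact: hg.
- apply: le_trans fg _; apply: vlat_scale_r; first exact: e0_ge0.
  by apply: le_trans (ltW hM); rewrite lef_pV2 ?posrE// ler_nat ltnS leq_maxr.
- rewrite vabs_subC; apply: enorm_lt => //; last by apply: hN; exact: leq_maxl.
  by apply: order_idealB; exact: CI.
Qed.

Lemma hom_of_complete : (0 < n)%N -> enorm_complete_on e C ->
  exists Phi : ph_lattice R n -> X,
    vlat_hom Phi /\ (forall i, Phi (phfun_proj R i) = x i).
Proof.
move=> n0 /(approximable_total n0)/choice[Phi hPhi]; exists Phi.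
split; last first.
  move=> i; apply: approximable_uniq (hPhi _) _.
  exact/lattice_linear_approximable/LatticeLinearProj.
split.
- by move=> c f g; apply: approximable_uniq (hPhi _) _; exact: approximable_lin.
- by move=> f g; apply: approximable_uniq (hPhi _) _; exact: approximable_join.
- by move=> f g; apply: approximable_uniq (hPhi _) _; exact: approximable_meet.
Qed.

End Extension.

(** * Homomorphisms agree with lattice-linear expressions *)

Section Homomorphism.
Variables (R : realType) (X : vectorLatticeType R) (n : nat) (x : 'I_n -> X).
Variable Phi : ph_lattice R n -> X.
Hypotheses (homPhi : vlat_hom Phi) (Phi_proj : forall i, Phi (phfun_proj R i) = x i).
Implicit Types (f g : ph_lattice R n) (y z : X).
Let e0 := ph_unit R n.
Let e := vabs_sup x.

Lemma hom_lin (c : R) f g : Phi (c *: f + g) = c *: Phi f + Phi g.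
Proof. by have [h _ _] := homPhi; exact: h. Qed.

Lemma homU f g : Phi (f `|` g)%O = (Phi f `|` Phi g)%O.
Proof. by have [_ h _] := homPhi; exact: h. Qed.

Lemma homI f g : Phi (f `&` g)%O = (Phi f `&` Phi g)%O.
Proof. by have [_ _ h] := homPhi; exact: h. Qed.

Lemma hom0 : Phi 0 = 0.
Proof.
have := hom_lin (-1) 0 0; rewrite scaler0 addr0 scaleN1r.
by rewrite addNr.
Qed.

Lemma homZ (c : R) f : Phi (c *: f) = c *: Phi f.
Proof. by have := hom_lin c f 0; rewrite hom0 !addr0. Qed.

Lemma homD f g : Phi (f + g) = Phi f + Phi g.
Proof. by have := hom_lin 1 f g; rewrite !scale1r. Qed.

Lemma homN f : Phi (- f) = - Phi f.
Proof. by have := homZ (-1) f; rewrite !scaleN1r. Qed.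

Lemma homB f g : Phi (f - g) = Phi f - Phi g.
Proof. by rewrite homD homN. Qed.

Lemma hom_abs f : Phi (vabs f) = vabs (Phi f).
Proof. by rewrite homU homN. Qed.

Lemma hom_le f g : f <= g -> Phi f <= Phi g.
Proof. by move=> /join_idPl fg; rewrite -fg homU leUr. Qed.

Lemma hom_lattice_linear f y : lattice_linear x f y -> Phi f = y.
Proof.
elim=> [|i|c {}f {}y g z _ <- _ <-|{}f {}y g z _ <- _ <-|{}f {}y g z _ <- _ <-].
- exact: hom0.
- exact: Phi_proj.
- exact: hom_lin.
- exact: homU.
- exact: homI.
Qed.

Lemma hom_unit : Phi e0 = e.
Proof. exact/hom_lattice_linear/lattice_linear_abs_sup. Qed.

Lemma hom_dist_le f g (c : R) : vabs (f - g) <= c *: e0 ->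
  vabs (Phi f - Phi g) <= c *: e.
Proof. by move=> /hom_le; rewrite hom_abs homB homZ hom_unit. Qed.

Lemma hom_approximable f : approximable x e f (Phi f).
Proof.
move=> eps eps0; have [g [z [hg fg]]] := @lattice_linear_dense R n X x f eps eps0.
by exists g, z; split=> //; rewrite -(hom_lattice_linear hg); exact: hom_dist_le.
Qed.

End Homomorphism.

(** * Uniform completeness of the positively homogeneous functions *)

Section PhComplete.
Variables (R : realType) (n : nat).
Implicit Types (f g : ph_lattice R n) (s t : 'rV[R]_n).
Let e0 := ph_unit R n.

Lemma half_pow_small (M eps : R) : 0 <= M -> 0 < eps ->
  exists k, 2^-1 ^+ k * M < eps.
Proof.
move=> M0 eps0; exists (Num.bound (M / eps)).
have := archi_boundP (divr_ge0 M0 (ltW eps0)); set k := Num.bound _ => Mk.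
rewrite exprVn mulrC ltr_pdivrMr ?exprn_gt0// mulrC -ltr_pdivrMr//.
by rewrite (lt_le_trans Mk)// -natrX ler_nat ltnW// ltn_expl.
Qed.

Lemma ph_unit_dist_le f g (c : R) t : vabs (f - g) <= c *: e0 ->
  `|ph_val f t - ph_val g t| <= c * ph_val e0 t.
Proof. by move=> /ph_leP/(_ t); rewrite ph_val_abs ph_valZ. Qed.

(** Uniform convergence on the sphere is, by homogeneity, convergence with an
    error proportional to [ph_unit], which is locally bounded; so homogeneity
    and continuity pass to the limit. *)
Lemma ph_uniform_limit (g : nat -> ph_lattice R n) (h : 'rV[R]_n -> R) (M : R) :
  0 <= M ->
  (forall k t, `|h t - ph_val (g k) t| <= 2^-1 ^+ k * M * ph_val e0 t) ->
  exists f, forall t, ph_val f t = h t.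
Proof.
move=> M0 hg; have M'0 t : 0 <= M * ph_val e0 t by rewrite mulr_ge0 ?ph_unit_ge0.
have ch : continuous h.
  move=> t; apply/(@cvgrPdist_lt _ _ _ (nbhs t) _ h (h t)) => eps eps0.
  have [||k hk] := @half_pow_small (M * (2 * ph_val e0 t + 1)) (eps / 2) _ _.
  - by rewrite mulr_ge0// addr_ge0// mulr_ge0// ph_unit_ge0.
  - by rewrite divr_gt0.
  have eps20 : 0 < eps / 2 by rewrite divr_gt0.
  apply: filterS2 (ph_val_near e0 t ltr01) (ph_val_near (g k) t eps20).
  move=> s /= h1 h2.
  have h3 := hg k t; have h4 := hg k s.
  have h5 : 2^-1 ^+ k * M * (ph_val e0 t + ph_val e0 s) <=
      2^-1 ^+ k * (M * (2 * ph_val e0 t + 1)).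
    rewrite mulrA ler_wpM2l//; first by rewrite mulr_ge0// exprn_ge0.
    by move: h1; rewrite ltr_norml => /andP[? ?]; lra.
  rewrite mulrDr in h5.
  move: h2 h3 h4; rewrite ltr_norml !ler_norml => /andP[? ?] /andP[? ?] /andP[? ?].
  by rewrite ltr_norml; apply/andP; split; lra.
have ph_h : h \in @ph_continuous R n.
  apply/asboolP; split=> [l t l0|]; last exact: ch.
    apply/eqP; rewrite -subr_eq0 -normr_le0; apply/ler_addgt0Pr => eps eps0.
    have [|k hk] := @half_pow_small (2 * (l * (M * ph_val e0 t))) eps _ eps0.
      by rewrite mulr_ge0// mulr_ge0.
    have h1 := hg k (l *: t).
    have h2 := ler_wpM2l l0 (hg k t).
    rewrite -{1}(ger0_norm l0) -normrM mulrBr in h2.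
    rewrite !ph_val_homo// in h1.
    have := ler_normB (h (l *: t) - l * ph_val (g k) t)
      (l * h t - l * ph_val (g k) t).
    rewrite opprB addrA subrK add0r; set a := _ ^+ k in hk h1 h2 *.
    by set b := ph_val e0 t in hk h1 h2 *; nra.
by exists (Phfun ph_h : ph_lattice R n).
Qed.

(** The tail after [k] terms is at most 2 * 2^-k times [ph_unit], so the partial
    sums lowered by this bound increase and those raised by it decrease; the
    limit is the supremum of the lowered ones. *)
Lemma ph_series_cvg (d : nat -> ph_lattice R n) :
  (forall k, vabs (d k) <= 2^-1 ^+ k *: e0) ->
  exists f, forall k, vabs (f - \sum_(i < k) d i) <= (2^-1 ^+ k * 2) *: e0.
Proof.
move=> hd; pose g k := \sum_(i < k) d i.
have gS k t : `|ph_val (g k.+1) t - ph_val (g k) t| <= 2^-1 ^+ k * ph_val e0 t.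
  apply: ph_unit_dist_le; rewrite /g big_ord_recr /= addrAC subrr add0r.
  exact: hd.
pose lo t k := ph_val (g k) t - 2^-1 ^+ k * 2 * ph_val e0 t.
pose up t k := ph_val (g k) t + 2^-1 ^+ k * 2 * ph_val e0 t.
have pow_ge0 k : 0 <= (2^-1 : R) ^+ k by rewrite exprn_ge0.
have lo_mono t : {homo lo t : i j / (i <= j)%N >-> i <= j}.
  apply: homo_leq => [r|r p q|k]; [exact: lexx|exact: le_trans|].
  have := gS k t; rewrite /lo exprS ler_norml => /andP[? ?].
  lra.
have up_mono t : {homo up t : i j / (i <= j)%N >-> j <= i}.
  apply: homo_leq => [r|r p q pr qp|k]; [exact: lexx|exact: le_trans qp pr|].
  have := gS k t; rewrite /up exprS ler_norml => /andP[? ?].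
  lra.
have lo_up t i j : lo t i <= up t j.
  apply: (@le_trans _ _ (lo t (maxn i j))); first exact/lo_mono/leq_maxl.
  apply: (@le_trans _ _ (up t (maxn i j))); last exact/up_mono/leq_maxr.
  rewrite /lo /up lerD2l; have := mulr_ge0 (pow_ge0 (maxn i j)) (ph_unit_ge0 t).
  lra.
pose h t := sup (range (lo t)).
have hg k t : `|h t - ph_val (g k) t| <= 2^-1 ^+ k * 2 * ph_val e0 t.
  have : lo t k <= h t by apply: ub_le_sup; [exists (up t 0%N) => _ [i _ <-]|exists k].
  have : h t <= up t k by apply: ge_sup; [exists (lo t 0%N), 0%N|move=> _ [i _ <-]].
  by rewrite /lo /up ler_norml => ? ?; apply/andP; split; lra.
have [f fh] := ph_uniform_limit (ler0n R 2) hg.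
exists f => k; apply/ph_leP => t.
by rewrite ph_val_abs ph_valZ ph_valD ph_valN fh; exact: hg.
Qed.

End PhComplete.

(** * Completeness of the range of a homomorphism *)

Section Range.
Variables (R : realType) (X : vectorLatticeType R) (n : nat) (x : 'I_n -> X).
Variable Phi : ph_lattice R n -> X.
Hypotheses (hX : archimedean_vlat X) (homPhi : vlat_hom Phi).
Hypothesis Phi_proj : forall i, Phi (phfun_proj R i) = x i.
Implicit Types (f g : ph_lattice R n) (y z : X).
Let e0 := ph_unit R n.
Let e := vabs_sup x.
Let e_ge0 : 0 <= e. Proof. exact: vabs_sup_ge0. Qed.

Let e0_ge0 : 0 <= e0. Proof. exact: vabs_sup_ge0. Qed.

(** Truncating [f] between the multiples [- l] and [l] of [ph_unit] does not
    change its image, as the homomorphism turns it into the same truncation of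
    [Phi f].  So the norm on the range is the quotient norm. *)
Lemma hom_lift_small f (l : R) : 0 <= l -> vabs (Phi f) <= l *: e ->
  exists2 g, Phi g = Phi f & vabs g <= l *: e0.
Proof.
move=> l0 /vabsP[h1 h2].
exists ((f `&` (l *: e0)) `|` (- (l *: e0)))%O.
  rewrite (homU homPhi) (homI homPhi) (homN homPhi) (homZ homPhi).
  rewrite (hom_unit homPhi Phi_proj) (meet_idPl h1); apply/join_idPl.
  by rewrite -vlat_leN2 opprK.
have u_ge0 : 0 <= l *: e0 by apply: vscale_ge0; [exact: l0|exact: e0_ge0].
apply/vabsP; split.
  by rewrite leUx leIr /=; apply: (le_trans _ u_ge0); rewrite -vlat_leN2 opprK oppr0.
by rewrite -vlat_leN2 opprK leUr.
Qed.

(** Lift the increments of [v] to functions with the same bounds, and sum. *)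
Lemma hom_range_cvg (v : nat -> X) : (forall k, range Phi (v k)) ->
  (forall k, vabs (v k.+1 - v k) <= 2^-1 ^+ k *: e) ->
  exists f, forall k, vabs (Phi f - v k) <= (2^-1 ^+ k * 2) *: e.
Proof.
move=> vR dv.
have /choice[d hd] k : exists d, Phi d = v k.+1 - v k /\ vabs d <= 2^-1 ^+ k *: e0.
  have [f _ fE] := vR k; have [g _ gE] := vR k.+1.
  have [||h hE hle] := @hom_lift_small (g - f) (2^-1 ^+ k).
  - by rewrite exprn_ge0.
  - by rewrite (homB homPhi) fE gE.
  - by exists h; rewrite hE (homB homPhi) fE gE.
have [f hf] := ph_series_cvg (fun k => (hd k).2).
have [g0 _ g0E] := vR 0%N.
exists (f + g0) => k.
have Phi_sum m : Phi (\sum_(i < m) d i) = v m - v 0%N.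
  elim: m => [|m IH]; first by rewrite big_ord0 (hom0 homPhi) subrr.
  by rewrite big_ord_recr /= (homD homPhi) IH (hd m).1 addrC addrA subrK.
have -> : v k = Phi (\sum_(i < k) d i + g0).
  by rewrite (homD homPhi) Phi_sum g0E subrK.
apply: (hom_dist_le homPhi Phi_proj).
have -> : f + g0 - (\sum_(i < k) d i + g0) = f - \sum_(i < k) d i.
  by rewrite opprD addrACA subrr addr0.
exact: hf.
Qed.

Lemma half_powS (k : nat) : (2^-1 : R) ^+ k.+1 = 2^-1 ^+ k / 2.
Proof. by rewrite exprS mulrC. Qed.

Lemma half_pow_ge0 (k : nat) : 0 <= (2^-1 : R) ^+ k.
Proof. by rewrite exprn_ge0. Qed.

Lemma hom_order_ideal f : order_ideal e (Phi f).
Proof.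
have [M M0 fM] := ph_unit_bound f; exists M; split; first exact: M0.
have := hom_le homPhi fM.
by rewrite (hom_abs homPhi) (homZ homPhi) (hom_unit homPhi Phi_proj).
Qed.

(** This makes the range contain the closed sublattice generated by the
    [x i]. *)
Lemma hom_range_closed : closed_sublattice e (range Phi).
Proof.
split.
- by move=> _ [f _ <-]; exact: hom_order_ideal.
- split.
  + by exists 0 => //; exact: hom0.
  + by move=> a _ _ [f _ <-] [g _ <-]; exists (a *: f + g) => //; exact: hom_lin.
  + by move=> _ _ [f _ <-] [g _ <-]; exists (f `|` g)%O => //; exact: homU.
  + by move=> _ _ [f _ <-] [g _ <-]; exists (f `&` g)%O => //; exact: homI.
- move=> y Iy hy; have /choice[v hv] k : exists z, range Phi z /\
      vabs (y - z) <= (2^-1 ^+ k / 4) *: e.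
    have [|z Rz yz] := hy (2^-1 ^+ k / 4); first by rewrite divr_gt0// exprn_gt0.
    exists z; split=> //; apply: enorm_lt => //.
    apply: (order_idealB (lexx e)) => //.
    by have [f _ <-] := Rz; exact: hom_order_ideal.
  have [|k|f hf] := @hom_range_cvg v; first by move=> k; have [] := hv k.
    apply: (@le_trans _ _ ((2^-1 ^+ k.+1 / 4 + 2^-1 ^+ k / 4) *: e)).
      rewrite scalerDl; apply: (@vabs_dist_trans _ _ y); last by have [] := hv k.
      by rewrite vabs_subC; have [] := hv k.+1.
    apply: vlat_scale_r => //; rewrite half_powS; have := half_pow_ge0 k; lra.
  exists f => //; apply: (archimedean_dist_eq hX e_ge0) => eps eps0.
  have [|k hk] := @half_pow_small R 3 eps _ eps0; first by rewrite ler0n.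
  apply: (@le_trans _ _ ((2^-1 ^+ k * 2 + 2^-1 ^+ k / 4) *: e)).
    rewrite scalerDl; apply: (@vabs_dist_trans _ _ (v k)); first exact: hf.
    by rewrite vabs_subC; have [] := hv k.
  by apply: vlat_scale_r => //; have := half_pow_ge0 k; lra.
Qed.

Lemma complete_of_hom : (0 < n)%N ->
  enorm_complete_on e (closed_sublattice_gen e x).
Proof.
move=> n0; set C := closed_sublattice_gen e x.
have CR : C `<=` range Phi.
  apply: smallest_sub; first exact: hom_range_closed.
  by move=> _ [i _ <-]; exists (phfun_proj R i : ph_lattice R n).
have [CI _ Cc] : closed_sublattice e C.
  by apply: closed_sublattice_gen_closed => //; apply/vabs_supP.
move=> u Cu cu.
have uI k l : order_ideal e (u k - u l).
  by apply: (order_idealB (lexx e)); exact: CI.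
have /choice[N hN] k : exists N, forall p q, (N <= p)%N -> (N <= q)%N ->
    vabs (u p - u q) <= 2^-1 ^+ k *: e.
  have [|N hN] := cu (2^-1 ^+ k); first by rewrite exprn_gt0.
  by exists N => p q Np Nq; apply: enorm_lt => //; exact: hN.
(* A nondecreasing choice of indices, with [m k] at least [N k]. *)
pose m k := (\sum_(j < k.+1) N j)%N.
have Nm k : (N k <= m k)%N by rewrite /m big_ord_recr; exact: leq_addl.
have mS k : (m k <= m k.+1)%N by rewrite /m [leqRHS]big_ord_recr; exact: leq_addr.
have [k|k|f hf] := @hom_range_cvg (u \o m); first by apply: CR; exact: Cu.
  by apply: hN; [exact: leq_trans (Nm k) (mS k)|exact: Nm].
have dist_u k p : (N k <= p)%N -> vabs (u p - Phi f) <= (2^-1 ^+ k * 3) *: e.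
  move=> Np; have -> : 2^-1 ^+ k * 3 = 2^-1 ^+ k + 2^-1 ^+ k * 2 :> R by lra.
  rewrite scalerDl; apply: (@vabs_dist_trans _ _ (u (m k))); first exact: hN Np (Nm k).
  by rewrite vabs_subC; exact: hf.
have small (eps : R) : 0 < eps -> exists N, forall p, (N <= p)%N ->
    enorm e (u p - Phi f) < eps.
  move=> eps0; have [|k hk] := @half_pow_small R 3 eps _ eps0; first by rewrite ler0n.
  exists (N k) => p Np; apply: le_lt_trans hk; apply: enorm_le (dist_u _ _ Np).
  by rewrite mulr_ge0// half_pow_ge0.
exists (Phi f); last exact: small.
have [RI _ _] := hom_range_closed.
apply: Cc => [|eps eps0]; first by apply: RI; exists f.
have [p hp] := small eps eps0; exists (u p); first exact: Cu.
by rewrite enorm_subC; exact: hp.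
Qed.

End Range.

(** * The characterisation and uniqueness *)

Theorem proposition2p2 (R : realType) (X : vectorLatticeType R)
    (hX : archimedean_vlat X) (n : nat) (hn : (0 < n)%N) (x : 'I_n -> X) :
  [<-> (* (a) *)
       exists Phi : phfun R n -> X,
         vlat_hom Phi /\ (forall i, Phi (phfun_proj R i) = x i);
       (* (b) *)
       enorm_complete_on (vabs_sup x) (closed_sublattice_gen (vabs_sup x) x);
       (* (c) *)
       exists e : X, [/\ 0 <= e, vabs_sup x <= e &
         enorm_complete_on e (closed_sublattice_gen e x)]] /\
  ((exists Phi : phfun R n -> X,
      vlat_hom Phi /\ (forall i, Phi (phfun_proj R i) = x i)) ->
   exists! Phi : phfun R n -> X,
      vlat_hom Phi /\ (forall i, Phi (phfun_proj R i) = x i)).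
Proof.
split.
  tfae.
  - by move=> [Phi [homPhi Phi_proj]]; exact: (complete_of_hom hX homPhi Phi_proj hn).
  - by move=> h; exists (vabs_sup x); split; [exact: vabs_sup_ge0|exact: lexx|].
  - by move=> [e [_ xe he]]; exact: (hom_of_complete hX xe hn he).
move=> [Phi [homPhi Phi_proj]]; exists Phi; split=> [//|Psi [homPsi Psi_proj]].
apply/funext => f; apply: (approximable_uniq hX (lexx (vabs_sup x))).
  exact: (hom_approximable homPhi Phi_proj f).
exact: (hom_approximable homPsi Psi_proj f).
Qed.
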